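(* Let $d,n\ge2$, $\beta>0$, and let weights $J_1,\ldots,J_d\ge0$ with $\sum_{i=1}^d\kappa_iJ_i\le1$ be fixed (independent of $m$). For $m>0$ let $(g_x)_{x\in\mathcal X}$ be the Gaussian free field without boundary on the Hamming graph $\mathcal X=\{0,1,\ldots,n-1\}^d$ with these weights, mass $m$ and inverse temperature $\beta$, as defined in the context. Assume that the associated stochastic matrix $P$ (defined in the context) is irreducible. Then for all $x,x'\in\mathcal X$, as $m\to0$, $$n^dm^2\,\mathrm{Cov}(g_x,g_{x'})\to\frac1\beta .$$ In this limit the covariances $\mathrm{Cov}(g_x,g_{x'})$ diverge, while the scaled field $(mg_x)_{x\in\mathcal X}$ becomes perfectly correlated, i.e. $\mathrm{Corr}(mg_x,mg_{x'})\to1$ for all $x,x'\in\mathcal X$.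
   Context: $\rho(x,x')=|\{i:x_i\ne x_i'\}|$ is the Hamming distance; $R_i=\{(x,x')\in\mathcal X\times\mathcal X:\rho(x,x')=i\}$ (ordered pairs); $\kappa_i=\binom di(n-1)^i$. The Hamiltonian is $H\{(\xi_x)\}=\frac14\sum_{i=1}^dJ_i\sum_{(x,x')\in R_i}(\xi_x-\xi_{x'})^2+\frac{m^2}2\sum_{x\in\mathcal X}\xi_x^2$, and $(g_x)_{x\in\mathcal X}$ is the random vector in $\mathbb R^{\mathcal X}$ with density proportional to $e^{-\beta H}$. Put $w_i=\kappa_iJ_i$ for $1\le i\le d$ and $w_0=1-\sum_{i=1}^dw_i$; the stochastic matrix $P$ on $\mathcal X$ is $(P)_{x,x'}=w_{\rho(x,x')}/\kappa_{\rho(x,x')}$. *)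

(* Defs.v *)
From HB Require Import structures.
From mathcomp Require Import all_boot all_order all_algebra.
From mathcomp Require Import all_classical all_reals all_analysis.

Set Implicit Arguments.
Unset Strict Implicit.
Unset Printing Implicit Defensive.

Import Order.TTheory GRing.Theory Num.Theory.
Import numFieldNormedType.Exports.

Local Open Scope classical_set_scope.
Local Open Scope ring_scope.

(** * Lebesgue measure on [R^N], realised as [N.-tuple R] *)

Section tuple_cons.
Context (R : realType) (N : nat).

Definition tuple_cons (p : measurableTypeR R * N.-tuple R) : N.+1.-tuple R :=
  [the N.+1.-tuple R of p.1 :: p.2].

Lemma measurable_tuple_cons : measurable_fun [set: measurableTypeR R * N.-tuple R] tuple_cons.
Proof. exact: (measurable_cons measurable_fst measurable_snd). Qed.

Definition tuple_uncons (t : N.+1.-tuple R) : measurableTypeR R * N.-tuple R :=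
  (tnth t ord0, [tuple of behead t]).

Lemma measurable_tuple_uncons :
  measurable_fun [set: N.+1.-tuple R] tuple_uncons.
Proof.
apply: measurable_fun_pair; first exact: measurable_tnth.
exact: measurable_behead.
Qed.

Lemma tuple_consK : cancel tuple_cons tuple_uncons.
Proof. by case=> x t; congr pair; apply/val_inj. Qed.

End tuple_cons.

Section lebesgue_cons.
Context (R : realType) (N : nat).
Variable mu : {sigma_finite_measure set (N.-tuple R) -> \bar R}.

Definition lebesgue_cons : set (N.+1.-tuple R) -> \bar R :=
  pushforward (@lebesgue_measure R \x mu)%E (@tuple_cons R N).

Let lebesgue_cons0 : lebesgue_cons set0 = 0%E.
Proof.
by rewrite /lebesgue_cons /pushforward preimage_set0; exact: measure0.
Qed.

Let lebesgue_cons_ge0 A : (0 <= lebesgue_cons A)%E.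
Proof. by rewrite /lebesgue_cons /pushforward; exact: measure_ge0. Qed.

Let lebesgue_cons_sigma_additive : semi_sigma_additive lebesgue_cons.
Proof.
exact: (@measure_semi_sigma_additive _ _ _
  (measure_function_pushforward__canonical__measure_function_Measure
    (@lebesgue_measure R \x mu)%E (@measurable_tuple_cons R N))).
Qed.

HB.instance Definition _ := isMeasure.Build _ _ _ lebesgue_cons
  lebesgue_cons0 lebesgue_cons_ge0 lebesgue_cons_sigma_additive.

Let lebesgue_cons_sigma_finite : sigma_finite setT lebesgue_cons.
Proof.
have /sigma_finiteP[F [TF ndF Foo]] := sigma_finiteT (@lebesgue_measure R).
have /sigma_finiteP[G [TG ndG Goo]] := sigma_finiteT mu.
exists (fun k => @tuple_uncons R N @^-1` (F k `*` G k)).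
  rewrite -preimage_bigcup; apply/seteqP; split=> // t _.
  have [j _ Fj] : (\bigcup_i F i) (tnth t ord0) by rewrite -TF.
  have [k _ Gk] : (\bigcup_i G i) [tuple of behead t] by rewrite -TG.
  exists (maxn j k) => //; split => /=.
    by move: Fj; apply/subsetPset/ndF/leq_maxl.
  by move: Gk; apply/subsetPset/ndG/leq_maxr.
move=> k; have [mF Fk] := Foo k; have [mG Gk] := Goo k; split.
  rewrite -[X in measurable X]setTI; apply: measurable_tuple_uncons => //.
  exact: measurableX.
rewrite /lebesgue_cons /pushforward -comp_preimage.
rewrite (_ : _ \o _ = idfun); last exact/funext/tuple_consK.
by rewrite preimage_id product_measure1E// lte_mul_pinfty// ge0_fin_numE.
Qed.

HB.instance Definition _ := Measure_isSigmaFinite.Build _ _ _ lebesgue_cons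
  lebesgue_cons_sigma_finite.

End lebesgue_cons.

Fixpoint lebesgue_tuple (R : realType) (N : nat) :
    {sigma_finite_measure set (N.-tuple R) -> \bar R} :=
  match N with
  | 0 => [the {sigma_finite_measure set (0.-tuple R) -> \bar R}
          of \d_([tuple] : 0.-tuple R)]
  | N'.+1 => [the {sigma_finite_measure set (N'.+1.-tuple R) -> \bar R}
          of lebesgue_cons (lebesgue_tuple R N')]
  end.

Lemma lebesgue_tuple_box (R : realType) (N : nat) (A : 'I_N -> set R) :
  (forall i, measurable (A i)) ->
  (lebesgue_tuple R N [set t | forall i, A i (tnth t i)] =
   \prod_(i < N) lebesgue_measure (A i))%E.
Proof.
elim: N A => [|N IH] A mA.
  rewrite big_ord0 /= diracE mem_set// => -[]//.
rewrite big_ord_recl /= -IH => [|i]; last exact: mA.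
have mB : measurable [set t : N.-tuple R | forall i, A (lift ord0 i) (tnth t i)].
  rewrite (_ : [set _ | _] =
    \bigcap_(i : 'I_N) ((@tnth N R)^~ i @^-1` A (lift ord0 i))).
    apply: fin_bigcap_measurable => [|i _]; first exact: finite_finset.
    rewrite -[X in measurable X]setTI.
    by apply: measurable_tnth => //; exact: mA.
  by apply/seteqP; split=> t /= tA i; [move=> _|]; exact: tA.
apply: etrans (@product_measure1E _ _ (measurableTypeR R) _ R
  (@lebesgue_measure R) (lebesgue_tuple R N) _ _ (mA ord0) mB).
rewrite /lebesgue_cons /pushforward.
congr (product_measure1 _ _ _); apply/seteqP; split=> -[x t] /=.
  move=> xtA; split; first exact: (xtA ord0).
  by move=> i; have := xtA (lift ord0 i); rewrite tnthS.
move=> [xA tA] i; case: (unliftP ord0 i) => [j|] ->; last exact: xA.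
by rewrite tnthS.
Qed.

(** * Random vectors and densities *)

(* [R^I] is coordinatised by [#|I|.-tuple R] through the enumeration of [I]. *)
Definition density_proportional_to (R : realType) (I : finType)
    (dsp : measure_display) (T : measurableType dsp) (P : probability T R)
    (g : I -> {RV P >-> R}) (f : (I -> R) -> R) : Prop :=
  exists2 c : R, 0 < c &
    forall A : set (#|I|.-tuple R), measurable A ->
      P ((fun t => [tuple g (enum_val i) t | i < #|I|]) @^-1` A) =
      (\int[lebesgue_tuple R #|I|]_(v in A)
         (c * f (fun x => tnth v (enum_rank x)))%:E)%E.

Definition correlation (R : realType) (dsp : measure_display)
    (T : measurableType dsp) (P : probability T R) (X Y : T -> R) : \bar R :=
  (covariance P X Y / (sqrte 'V_P[X] * sqrte 'V_P[Y]))%E.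

(** * Markov chains *)

Definition irreducible_mx (R : realType) (N : nat) (P : 'M[R]_N) : Prop :=
  forall i j : 'I_N, exists k : nat, 0 < (P ^+ k) i j.

(** * The Hamming graph and its Gaussian free field *)

Definition hamming (d n : nat) : finType := {ffun 'I_d -> 'I_n}.

Section hamming.
Context (R : realType) (d n : nat).
Implicit Types (x y : hamming d n) (J : nat -> R).

Definition rho x y : nat := #|[set i : 'I_d | x i != y i]%SET|.

Definition shell (i : nat) : {set hamming d n * hamming d n} :=
  [set p | rho p.1 p.2 == i]%SET.

Definition kappa (i : nat) : nat := 'C(d, i) * (n - 1) ^ i.

(* Only the values [J 1], ..., [J d] are used, here and below. *)
Definition hamiltonian J (m : R) (xi : hamming d n -> R) : R :=
  4%:R^-1 * (\sum_(1 <= i < d.+1)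
     J i * \sum_(p in shell i) (xi p.1 - xi p.2) ^+ 2)
  + m ^+ 2 / 2%:R * \sum_(x : hamming d n) xi x ^+ 2.

Definition is_gff J (beta m : R) (dsp : measure_display)
    (T : measurableType dsp) (P : probability T R)
    (g : hamming d n -> {RV P >-> R}) : Prop :=
  density_proportional_to g (fun xi => expR (- (beta * hamiltonian J m xi))).

Definition weight J (i : nat) : R :=
  if i == 0%N then 1 - \sum_(1 <= j < d.+1) (kappa j)%:R * J j
  else (kappa i)%:R * J i.

Definition transition_mx J : 'M[R]_#|hamming d n| :=
  \matrix_(i, j) (weight J (rho (enum_val i) (enum_val j))
                  / (kappa (rho (enum_val i) (enum_val j)))%:R).

End hamming.

(* Main.v *)
(** Write the Hamiltonian as half the quadratic form of [Q = L + m^2], where [L]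
    is the Laplacian of the weighted Hamming graph. Lebesgue measure is invariant
    under translation by [b Q^-1 / beta], and completing the square gives
    [E exp <b, g> = exp (b Q^-1 b^T / (2 beta))]. The first two moments of
    [<b, g>] are read off from the small-[t] behaviour of [E exp (t <b, g>)], so
    [Cov (g_x, g_y) = (Q^-1)_xy / beta]. Irreducibility makes the kernel of [L]
    the constants, so with [K] the matrix with all entries [n^-d] the matrix
    [G = (L + K)^-1] exists and inverts [L] on sum-zero vectors. The identity
    [m^2 Q^-1 = K + m^2 (G - m^2 Q^-1 G)], together with the bound 1 on the
    entries of [m^2 Q^-1], gives [m^2 Q^-1 = K + O(m^2)]. *)

Require Import Defs.
From HB Require Import structures.
From mathcomp Require Import all_boot all_order all_algebra.
From mathcomp Require Import all_classical all_reals all_analysis.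
From mathcomp Require Import ring lra measurable_realfun.

Set Implicit Arguments.
Unset Strict Implicit.
Unset Printing Implicit Defensive.

Import Order.TTheory GRing.Theory Num.Theory.
Import numFieldNormedType.Exports.

Local Open Scope classical_set_scope.
Local Open Scope ring_scope.

(** * Moments from the moment generating function *)

(** The second difference in [t] of [expR (t * y)] recovers [y ^+ 2] with an error linear in [t].
    The factor in [y] is integrable as soon as the moment generating function is finite at 2 and -2,
    so the second moment needs no limit theorem for integrals. *)
Lemma second_difference_expR_bound (R : realType) (t y : R) : 0 < t <= 1 ->
  `|y ^+ 2 - (expR (t * y) + expR (- (t * y)) - 2) / t ^+ 2| <=
  27 * t * (expR (2 * y) + expR (- (2 * y))).
Proof.
move=> /andP[t0 t1].
wlog y0 : y / 0 <= y => [hw|].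
  have [|/ltW y0] := leP 0 y; first exact: hw.
  have := hw (- y); rewrite oppr_ge0 => /(_ y0); rewrite sqrrN !mulrN !opprK.
  by rewrite (addrC (expR _)) (addrC (expR (- (2 * y)))).
set u := t * y.
have u0 : 0 <= u by rewrite mulr_ge0// ltW.
have uy : u <= y by rewrite ler_piMl.
have e1 (v : R) : 0 <= v -> 1 <= expR v.
  by move=> v0; rewrite -[leLHS]expR0 ler_expR.
have eV (v : R) : expR v * expR (- v) = 1 by rewrite -expRD subrr expR0.
have split2 : expR (u / 2) ^+ 2 = expR u by rewrite -expRM_natl -mulr_natl; congr expR; field.
have split2N : expR (- (u / 2)) ^+ 2 = expR (- u).
  by rewrite -expRM_natl -mulr_natl; congr expR; field.
(* Half exponents turn the second difference into the square of [a - b]. The inequality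
   [1 + v <= expR v] then encloses it between [u ^+ 2 * expR (- u)] and [u ^+ 2 * expR u]. *)
set a := expR (u / 2) in split2 *; set b := expR (- (u / 2)) in split2N *.
have ab : a * b = 1 by exact: eV.
have a0 : 0 < a by exact: expR_gt0.
have b0 : 0 < b by exact: expR_gt0.
have E2 : expR u + expR (- u) - 2 = (a - b) ^+ 2.
  by rewrite -split2 -split2N; ring: ab.
have b2 : b ^+ 2 >= 1 - u by rewrite split2N; have := expR_ge1Dx (- u); lra.
have a2 : a ^+ 2 >= 1 + u by rewrite split2; exact: expR_ge1Dx.
have hi : a - b <= u * a.
  rewrite (_ : a - b = a * (1 - b ^+ 2)); last by ring: ab.
  by rewrite mulrC ler_pM2r//; lra.
have lo : u * b <= a - b.
  rewrite (_ : a - b = (a ^+ 2 - 1) * b); last by ring: ab.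
  by rewrite ler_pM2r//; lra.
have ab0 : 0 <= a - b by apply: le_trans lo; rewrite mulr_ge0// ltW.
have hi2 : (a - b) ^+ 2 <= u ^+ 2 * expR u.
  by rewrite -split2 -exprMn; apply: lerXn2r; rewrite ?nnegrE ?mulr_ge0// ltW.
have lo2 : u ^+ 2 * expR (- u) <= (a - b) ^+ 2.
  by rewrite -split2N -exprMn; apply: lerXn2r; rewrite ?nnegrE ?mulr_ge0// ltW.
have eu1 : expR u - 1 <= u * expR u.
  rewrite (_ : expR u - 1 = (1 - expR (- u)) * expR u); last first.
    by rewrite mulrBl mul1r mulrC eV.
  rewrite ler_pM2r ?expR_gt0//; have := expR_ge1Dx (- u); lra.
have dist : `|u ^+ 2 - (a - b) ^+ 2| <= u ^+ 3 * expR u.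
  have u2 : 0 <= u ^+ 2 by exact: sqr_ge0.
  have k1 : u ^+ 2 * (expR u - 1) <= u ^+ 3 * expR u.
    by rewrite (exprSr u 2) -mulrA ler_wpM2l.
  have k2 : u ^+ 2 * (1 - expR (- u)) <= u ^+ 3 * expR u.
    rewrite (exprSr u 2) -mulrA ler_wpM2l//; have := expR_ge1Dx (- u).
    have : u <= u * expR u by rewrite ler_peMr// e1.
    lra.
  by rewrite ler_norml; apply/andP; split; lra.
(* The constant 27 is [3 ^+ 3], from cubing [y / 3 <= expR (y / 3)]. A second factor [expR y] will
   bound [expR u], as [u <= y]; together they give [expR (2 * y)]. *)
have y3 : y ^+ 3 <= 27 * expR y.
  have h : y / 3 <= expR (y / 3) by have := expR_ge1Dx (y / 3); lra.
  have -> : expR y = expR (y / 3) ^+ 3.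
    by rewrite -expRM_natl; congr expR; field.
  have : (y / 3) ^+ 3 <= expR (y / 3) ^+ 3.
    by rewrite lerXn2r ?nnegrE ?expR_ge0//; lra.
  rewrite exprMn exprVn; lra.
rewrite E2 (_ : y ^+ 2 = u ^+ 2 / t ^+ 2); last by rewrite /u; field; rewrite gt_eqF.
rewrite -mulrBl normrM (gtr0_norm (x := (t ^+ 2)^-1)) ?invr_gt0 ?exprn_gt0//.
rewrite ler_pdivrMr ?exprn_gt0//; apply: le_trans dist _.
have -> : u ^+ 3 * expR u = t ^+ 3 * (y ^+ 3 * expR u) by rewrite /u; ring.
rewrite [leRHS](_ : _ = t ^+ 3 * (27 * (expR (2 * y) + expR (- (2 * y))))); last by ring.
rewrite ler_pM2l ?exprn_gt0//.
apply: (@le_trans _ _ (27 * expR y * expR y)).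
  by apply: ler_pM; rewrite ?exprn_ge0 ?expR_ge0 ?ler_expR.
rewrite -mulrA -expRD (_ : y + y = 2 * y); last by ring.
by rewrite ler_pM2l// lerDl expR_ge0.
Qed.

Lemma eq0_of_norm_le_linear (R : realFieldType) (a K : R) :
  (forall t, 0 < t <= 1 -> `|a| <= K * t) -> a = 0.
Proof.
move=> aK; apply/eqP; apply: contraT => a0.
have a_gt0 : 0 < `|a| by rewrite normr_gt0.
have K0 : `|a| <= K by have := aK 1; rewrite mulr1; apply; rewrite ltr01 lexx.
have K_gt0 : 0 < K by exact: lt_le_trans K0.
(* At this [t] the bound reads [|a| <= |a| / 2]. The case [t = 1] has given [|a| <= K], which keeps
   this [t] in range. *)
have := aK (`|a| / (2 * K)).
have -> : K * (`|a| / (2 * K)) = `|a| / 2 by field; rewrite gt_eqF.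
have -> : 0 < `|a| / (2 * K) <= 1.
  by rewrite divr_gt0 ?mulr_gt0//= ler_pdivrMr ?mulr_gt0// mul1r; lra.
move=> /(_ isT); lra.
Qed.

Section gaussian_moments.
Context (R : realType) (dsp : measure_display) (T : measurableType dsp).
Variables (P : probability T R) (Y : T -> R) (s : R).
Hypotheses (s0 : 0 <= s) (mY : measurable_fun setT Y).
Hypothesis mgfY : forall t : R,
  (\int[P]_w (expR (t * Y w))%:E = (expR (t ^+ 2 * s / 2))%:E)%E.

Let mexp t : measurable_fun setT (fun w => expR (t * Y w)).
Proof. by apply: measurableT_comp => //; exact: measurable_funM. Qed.

Let integrable_exp t : P.-integrable setT (EFin \o (fun w => expR (t * Y w))).
Proof.
apply/integrableP; split; first exact/measurable_EFinP.
under eq_integral do rewrite /= ger0_norm ?expR_ge0//.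
by rewrite mgfY ltry.
Qed.

Let integral_exp t : \int[P]_w expR (t * Y w) = expR (t ^+ 2 * s / 2).
Proof. by rewrite /Rintegral mgfY. Qed.

Let integrable_le (f g : T -> R) : measurable_fun setT f ->
  P.-integrable setT (EFin \o g) -> (forall w, `|f w| <= g w) ->
  P.-integrable setT (EFin \o f).
Proof.
move=> mf ig fg; apply: (le_integrable _ _ _ ig) => //; first exact/measurable_EFinP.
by move=> w _ /=; rewrite lee_fin (le_trans (fg w))// ler_norm.
Qed.

Let integrable_cosh t : P.-integrable setT
  (EFin \o (fun w => expR (t * Y w) + expR (- (t * Y w)))).
Proof.
have := integrableD measurableT (integrable_exp t) (integrable_exp (- t)).
apply: eq_integrable => // w _ /=.
by rewrite -EFinD mulNr.
Qed.

Let integral_cosh t : \int[P]_w (expR (t * Y w) + expR (- (t * Y w))) =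
  2 * expR (t ^+ 2 * s / 2).
Proof.
under eq_Rintegral do rewrite -mulNr.
by rewrite RintegralD// !integral_exp sqrrN; ring.
Qed.

Lemma integrable_of_mgf : P.-integrable setT (EFin \o Y).
Proof.
apply: (integrable_le mY (integrable_cosh 1)) => w; rewrite mul1r.
have := expR_ge1Dx (Y w); have := expR_ge1Dx (- Y w).
have := expR_gt0 (Y w); have := expR_gt0 (- Y w).
by rewrite ler_norml => *; apply/andP; split; lra.
Qed.

Lemma integrable_sqr_of_mgf : P.-integrable setT (EFin \o (fun w => Y w ^+ 2)).
Proof.
have mY2 : measurable_fun setT (fun w => Y w ^+ 2) by exact: measurable_funX.
(* The dominating function is the second-difference bound at [t = 1]; 28 in place of 27 is slack. *)
apply: (integrable_le (g := fun w => expR (1 * Y w) + expR (- (1 * Y w)) +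
  28 * (expR (2 * Y w) + expR (- (2 * Y w)))) mY2).
  have := integrableZl measurableT 28 (integrable_cosh 2).
  by have /(integrableD measurableT) /[apply] := integrable_cosh 1.
move=> w.
have := @second_difference_expR_bound R 1 (Y w).
rewrite ltr01 lexx => /(_ isT); rewrite expr1n divr1 !mul1r mulr1 ler_norml.
rewrite (ger0_norm (sqr_ge0 _)) => /andP[_ +].
have := expR_gt0 (2 * Y w); have := expR_gt0 (- (2 * Y w)).
by lra.
Qed.

Let expR_sub1_le t : 0 < t <= 1 ->
  expR (t ^+ 2 * s / 2) - 1 <= t ^+ 2 * s / 2 * expR (s / 2).
Proof.
move=> /andP[t0 t1]; set h := _ / 2.
have h0 : 0 <= h by rewrite /h divr_ge0// mulr_ge0// sqr_ge0.
have hs : h <= s / 2.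
  by rewrite /h -mulrA ler_piMl ?divr_ge0// expr_le1// ltW.
apply: (@le_trans _ _ (h * expR h)); last by rewrite ler_wpM2l// ler_expR.
have -> : expR h - 1 = (1 - expR (- h)) * expR h.
  by rewrite mulrBl mul1r -expRD addNr expR0.
by rewrite ler_pM2r ?expR_gt0//; have := expR_ge1Dx (- h); lra.
Qed.

(** Integrating [1 + c * Y <= expR (c * Y)] for [c = t] and [c = - t] bounds [t] times the absolute
    mean by a multiple of [t ^+ 2]. *)
Lemma mean0_of_mgf : \int[P]_w Y w = 0.
Proof.
apply: (@eq0_of_norm_le_linear _ _ (s / 2 * expR (s / 2))) => t t01.
have t0 : 0 < t by case/andP: t01.
have bound (c : R) : c ^+ 2 = t ^+ 2 ->
    c * \int[P]_w Y w <= t ^+ 2 * s / 2 * expR (s / 2).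
  move=> ct; rewrite -RintegralZl//; last exact: integrable_of_mgf.
  apply: le_trans (expR_sub1_le t01); rewrite -ct -integral_exp.
  rewrite -[X in _ - X](_ : \int[P]_w (cst 1 w) = 1); last first.
    by rewrite Rintegral_cst//= probability_setT mul1r.
  have i1 : P.-integrable setT (EFin \o cst 1) by exact: finite_measure_integrable_cst.
  rewrite -RintegralB//; apply: le_Rintegral => //.
  - by have := integrableZl measurableT c integrable_of_mgf.
  - by have := integrableB measurableT (integrable_exp c) i1.
  - by move=> w _ /=; have := expR_ge1Dx (c * Y w); lra.
have := bound t erefl; have := bound (- t) (sqrrN t).
have -> : t ^+ 2 * s / 2 * expR (s / 2) = t * (s / 2 * expR (s / 2) * t) by ring.
rewrite mulNr -mulrN !ler_pM2l// => ? ?.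
by rewrite ler_norml; apply/andP; split; lra.
Qed.

(** The mean of the second difference [D] is explicit and within O(t) of [s]. By the pointwise bound
    it is also within O(t) of the second moment. *)
Lemma second_moment_of_mgf : \int[P]_w (Y w ^+ 2) = s.
Proof.
apply/eqP; rewrite -subr_eq0; apply/eqP.
(* The first constant is 27 times [2 * expR (2 * s)], the mean of the dominating function; the
   second is the error between the mean of [D] and [s]. *)
apply: (@eq0_of_norm_le_linear _ _
  (54 * expR (2 * s) + s ^+ 2 / 2 * expR (s / 2))) => t t01.
have /andP[t0 t1] := t01.
pose D w := (expR (t * Y w) + expR (- (t * Y w)) - 2) / t ^+ 2.
have i2 : P.-integrable setT (EFin \o cst 2) by exact: finite_measure_integrable_cst.
have iD0 : P.-integrable setT
    (EFin \o (fun w => expR (t * Y w) + expR (- (t * Y w)) - 2)).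
  by have := integrableB measurableT (integrable_cosh t) i2.
have iD : P.-integrable setT (EFin \o D).
  by have := integrableZr measurableT (t ^+ 2)^-1 iD0.
have intD : \int[P]_w D w = 2 * (expR (t ^+ 2 * s / 2) - 1) / t ^+ 2.
  rewrite RintegralZr// RintegralB// integral_cosh Rintegral_cst//.
  have -> : fine (P setT) = 1 by rewrite probability_setT.
  by rewrite /=; ring.
have i27 : P.-integrable setT (EFin \o
    (fun w => 27 * t * (expR (2 * Y w) + expR (- (2 * Y w))))).
  by have := integrableZl measurableT (27 * t) (integrable_cosh 2).
have close : `|\int[P]_w (Y w ^+ 2) - \int[P]_w D w| <= 54 * expR (2 * s) * t.
  have iB := integrableB measurableT integrable_sqr_of_mgf iD.
  rewrite -RintegralB//; last exact: integrable_sqr_of_mgf.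
  apply: (le_trans (le_normr_Rintegral _ _)) => //.
  apply: (@le_trans _ _ (\int[P]_w
      (27 * t * (expR (2 * Y w) + expR (- (2 * Y w)))))).
    apply: le_Rintegral => //; first exact: (integrable_norm iB).
    by move=> w _; exact: second_difference_expR_bound.
  rewrite RintegralZl// integral_cosh (_ : 2 ^+ 2 * s / 2 = 2 * s); last by field.
  by rewrite le_eqVlt; apply/orP; left; apply/eqP; ring.
have lo : s <= \int[P]_w D w.
  rewrite intD ler_pdivlMr ?exprn_gt0//.
  by have := expR_ge1Dx (t ^+ 2 * s / 2); lra.
have hi : \int[P]_w D w <= s + s ^+ 2 / 2 * expR (s / 2) * t.
  rewrite intD ler_pdivrMr ?exprn_gt0//.
  have := expR_ge1Dx (- (t ^+ 2 * s / 2)).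
  set h := _ / 2 => h1.
  have eh : expR h - 1 <= h * expR h.
    have -> : expR h - 1 = (1 - expR (- h)) * expR h.
      by rewrite mulrBl mul1r -expRD addNr expR0.
    by rewrite ler_pM2r ?expR_gt0//; lra.
  have ht : 2 * h = t ^+ 2 * s by rewrite /h; field.
  have := expR_sub1_le t01; rewrite -/h => e2.
  have h0 : 0 <= h by rewrite /h divr_ge0// mulr_ge0// sqr_ge0.
  (* Using the estimate on [expR h - 1] twice gives [expR h - 1 <= h + h ^+ 2 * expR (s / 2)], whose
     leading term is exactly [t ^+ 2 * s / 2]. *)
  have hh : h * (expR h - 1) <= h * (h * expR (s / 2)) by rewrite ler_wpM2l.
  have tt : t ^+ 4 * (s ^+ 2 / 2 * expR (s / 2)) <= t ^+ 3 * (s ^+ 2 / 2 * expR (s / 2)).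
    rewrite ler_wpM2r ?mulr_ge0 ?sqr_ge0 ?expR_ge0//.
    by rewrite (exprSr t 3) ler_piMr// exprn_ge0// ltW.
  have : h * (h * expR (s / 2)) * 2 = t ^+ 4 * (s ^+ 2 / 2 * expR (s / 2)).
    by rewrite /h; field.
  by move=> hX; lra.
rewrite (le_trans (ler_distD (\int[P]_w D w) _ _))// mulrDl lerD//.
by rewrite ger0_norm; lra.
Qed.

End gaussian_moments.

(** * Translation invariance and densities *)

(** Lebesgue measure is determined by its values on half-open intervals, and a shift preserves their
    lengths. *)
Lemma lebesgue_measure_translation (R : realType) (a : R) (A : set R) :
  measurable A ->
  pushforward (@lebesgue_measure R) ((fun x => x + a) : _ -> measurableTypeR R) A
  = lebesgue_measure A.
Proof.
move=> mA; apply/esym/lebesgue_measure_unique => //=.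
  exact: measurable_funD.
move=> _ _ [[b c]] _ <-; rewrite /pushforward.
rewrite (_ : _ @^-1` _ = `]b - a, c - a]%classic); last first.
  by apply/seteqP; split => x /=; rewrite !in_itv/= ltrBlDr lerBrDr.
rewrite !lebesgue_measure_itv/= !lte_fin ltrD2r -!EFinB.
by case: ifPn => // _; congr EFin; ring.
Qed.

Lemma ge0_integral_lebesgue_translation (R : realType) (a : R)
    (f : measurableTypeR R -> \bar R) :
  measurable_fun setT f -> (forall x, 0 <= f x)%E ->
  (\int[lebesgue_measure]_x f (x + a)%R = \int[lebesgue_measure]_x f x)%E.
Proof.
move=> mf f0.
have mT : measurable_fun setT ((fun x => x + a) : measurableTypeR R -> measurableTypeR R).
  exact: measurable_funD.
transitivity (\int[pushforward lebesgue_measure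
    ((fun x => x + a)%R : measurableTypeR R -> measurableTypeR R)]_x f x)%E.
  by rewrite ge0_integral_pushforward.
by apply: eq_measure_integral => //= A mA _; exact: lebesgue_measure_translation.
Qed.

Definition tuple_add (R : realType) (N : nat) (a : 'I_N -> R) (v : N.-tuple R) :
  N.-tuple R := [tuple tnth v i + a i | i < N].

Lemma measurable_tuple_add (R : realType) (N : nat) (a : 'I_N -> R) :
  measurable_fun setT (tuple_add a).
Proof.
apply/measurable_fun_tnthP => i.
rewrite (_ : _ \o _ = (fun v => tnth v i + a i)); last first.
  by apply/funext => v /=; rewrite tnth_mktuple.
by apply: measurable_funD => //; exact: measurable_tnth.
Qed.

Lemma ge0_integral_lebesgue_cons (R : realType) (N : nat)
    (f : N.+1.-tuple R -> \bar R) :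
  measurable_fun setT f -> (forall v, 0 <= f v)%E ->
  (\int[lebesgue_tuple R N.+1]_v f v =
   \int[lebesgue_measure]_x \int[lebesgue_tuple R N]_t f (tuple_cons (x, t)))%E.
Proof.
move=> mf f0; rewrite /= /lebesgue_cons.
rewrite ge0_integral_pushforward//; last exact: measurable_tuple_cons.
rewrite preimage_setT fubini_tonelli1// => [|x]; last exact: f0.
by apply: measurableT_comp => //; exact: measurable_tuple_cons.
Qed.

(** Tonelli splits off the first coordinate. The induction hypothesis removes the shift of the
    others, and the one-dimensional case removes the last shift. *)
Lemma ge0_integral_lebesgue_tuple_translation (R : realType) (N : nat)
    (a : 'I_N -> R) (f : N.-tuple R -> \bar R) :
  measurable_fun setT f -> (forall v, 0 <= f v)%E ->
  (\int[lebesgue_tuple R N]_v f (tuple_add a v) = \int[lebesgue_tuple R N]_v f v)%E.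
Proof.
elim: N a f => [|N IH] a f mf f0.
  by apply: eq_integral => v _; congr f; rewrite (tuple0 v) (tuple0 (tuple_add _ _)).
rewrite !ge0_integral_lebesgue_cons//; last first.
  by apply: measurableT_comp => //; exact: measurable_tuple_add.
have mfc : measurable_fun setT (f \o @tuple_cons R N).
  by apply: measurableT_comp => //; exact: measurable_tuple_cons.
pose a' i := a (lift ord0 i).
transitivity (\int[lebesgue_measure]_x
    \int[lebesgue_tuple R N]_t f (tuple_cons (x + a ord0, t)%R))%E.
  apply: eq_integral => x _.
  rewrite -(IH a' (fun t => f (tuple_cons (x + a ord0, t)%R)))//.
    apply: eq_integral => t _; congr f; apply/eq_from_tnth => i.
    rewrite tnth_mktuple; case: (unliftP ord0 i) => [j|] ->.
      by rewrite !tnthS tnth_mktuple.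
    by rewrite !tnth0.
  by apply: (measurableT_comp mfc); exact: pair1_measurable.
rewrite (ge0_integral_lebesgue_translation (a ord0)
  (f := fun x => \int[lebesgue_tuple R N]_t f (tuple_cons (x, t)))%E)//.
- exact: (measurable_fun_fubini_tonelli_F (m2 := lebesgue_tuple R N)
    (f \o @tuple_cons R N) mfc
    (fun p => f0 (tuple_cons p))).
- by move=> x; apply: integral_ge0 => *; exact: f0.
Qed.

(** The passage from sets to nonnegative functions goes through Radon-Nikodym: the law of [X] is
    absolutely continuous, its derivative agrees almost everywhere with [f], and the change of
    variables for that derivative applies. *)
Lemma ge0_integral_distribution_density (R : realType) (d1 d2 : measure_display)
    (T : measurableType d1) (U : measurableType d2) (P : probability T R)
    (mu : {sigma_finite_measure set U -> \bar R}) (X : {RV P >-> U})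
    (f : U -> R) (F : U -> \bar R) :
  measurable_fun setT f ->
  (forall A, measurable A -> P (X @^-1` A) = \int[mu]_(v in A) (f v)%:E)%E ->
  measurable_fun setT F -> (forall v, 0 <= F v)%E ->
  (\int[P]_w F (X w) = \int[mu]_v (F v * (f v)%:E))%E.
Proof.
move=> mf Xf mF F0.
have PX : distribution P X `<< mu.
  apply/null_content_dominatesP => A mA muA0.
  rewrite /distribution /pushforward Xf//; apply: null_set_integral => //.
  exact/measurable_EFinP/measurable_funTS.
pose h := Radon_Nikodym_SigmaFinite.f (distribution P X) mu.
have ih : mu.-integrable setT h by exact: Radon_Nikodym_SigmaFinite.f_integrable.
have hf : ae_eq mu setT h (EFin \o f).
  apply: integral_ae_eq => //; first exact/measurable_EFinP.
  move=> A _ mA; rewrite -Radon_Nikodym_SigmaFinite.f_integral//.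
  by rewrite -Xf.
rewrite -(ge0_integral_distribution X)//.
rewrite -(Radon_Nikodym_SigmaFinite.change_of_variables PX)//.
have mh := measurable_int _ ih.
apply: ae_eq_integral => //.
- exact: emeasurable_funM.
- by apply: emeasurable_funM => //; exact/measurable_EFinP.
- by apply: filterS hf => v + Dv => /(_ Dv) /= hv; congr (_ * _)%E.
Qed.

(** * Gaussian densities *)

Section bilinear_form.
Context (R : comNzRingType) (N : nat).
Implicit Types (M : 'M[R]_N) (u v w : 'rV[R]_N).

Definition bil M u v : R := (u *m M *m v^T) 0 0.

Lemma bilDl M u v w : bil M (u + v) w = bil M u w + bil M v w.
Proof. by rewrite /bil !mulmxDl mxE. Qed.

Lemma bilDr M u v w : bil M w (u + v) = bil M w u + bil M w v.
Proof. by rewrite /bil linearD mulmxDr mxE. Qed.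

Lemma bilZl M k u v : bil M (k *: u) v = k * bil M u v.
Proof. by rewrite /bil -!scalemxAl mxE. Qed.

Lemma bilZr M k u v : bil M u (k *: v) = k * bil M u v.
Proof. by rewrite /bil linearZ -scalemxAr mxE. Qed.

Lemma bilC M u v : M^T = M -> bil M u v = bil M v u.
Proof.
move=> MT; rewrite /bil; transitivity ((u *m M *m v^T)^T 0 0).
  by rewrite [RHS]mxE.
by rewrite !trmx_mul trmxK MT mulmxA.
Qed.

Lemma bil_delta M i j : bil M (delta_mx 0 i) (delta_mx 0 j) = M i j.
Proof. by rewrite /bil -rowE trmx_delta -colE !mxE. Qed.

End bilinear_form.

Definition tuple_row (R : Type) (N : nat) (v : N.-tuple R) : 'rV[R]_N :=
  \row_i tnth v i.

Section gaussian_density.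
Context (R : realType) (dsp : measure_display) (T : measurableType dsp).
Variables (P : probability T R) (N : nat) (X : {RV P >-> N.-tuple R}).
Variables (M : 'M[R]_N) (c : R).
Hypotheses (c_ge0 : 0 <= c) (MT : M^T = M) (M_unit : M \in unitmx).
Hypothesis M_ge0 : forall v, 0 <= bil M v v.
Hypothesis X_law : forall A, measurable A ->
  (P (X @^-1` A) = \int[lebesgue_tuple R N]_(v in A)
     (c * expR (- (bil M (tuple_row v) (tuple_row v) / 2)))%:E)%E.

Let V := invmx M.

Definition linear_functional (b : 'rV[R]_N) (v : N.-tuple R) : R :=
  \sum_i b 0 i * tnth v i.

Lemma linear_functionalE b v : linear_functional b v = bil 1%:M b (tuple_row v).
Proof. by rewrite /bil mulmx1 mxE; apply: eq_bigr => i _; rewrite !mxE. Qed.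

Lemma measurable_linear_functional b : measurable_fun setT (linear_functional b).
Proof.
apply: measurable_sum => i; apply: measurable_funM => //.
exact: measurable_tnth.
Qed.

Lemma measurable_bil_tuple :
  measurable_fun setT (fun v : N.-tuple R => bil M (tuple_row v) (tuple_row v)).
Proof.
rewrite (_ : (fun _ => _) = fun v => \sum_j (\sum_i tnth v i * M i j) * tnth v j).
  apply: measurable_sum => j; apply: measurable_funM; last exact: measurable_tnth.
  apply: measurable_sum => i; apply: measurable_funM => //; exact: measurable_tnth.
apply/funext => v; rewrite /bil mxE; apply: eq_bigr => j _; rewrite !mxE.
by congr (_ * _); apply: eq_bigr => i _; rewrite !mxE.
Qed.

Let VT : V^T = V. Proof. by rewrite /V trmx_inv MT. Qed.

Let tuple_row_add (a : 'rV[R]_N) v :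
  tuple_row (tuple_add (a 0) v) = tuple_row v + a.
Proof. by apply/rowP => i; rewrite !mxE tnth_mktuple. Qed.

(** This is the form of [M] at [b *m V]. The moment lemmas require a nonnegative variance. *)
Lemma gaussian_variance_ge0 b : 0 <= bil V b b.
Proof.
have := M_ge0 (b *m V); rewrite /bil trmx_mul VT -!mulmxA.
by rewrite [M *m _]mulmxA mulmxV// mul1mx.
Qed.

(* The translation v -> v + b M^-1 turns exp(<b,v>) times the density into a
   constant multiple of the density. *)
Lemma gaussian_mgf b : (\int[P]_w (expR (linear_functional b (X w)))%:E =
  (expR (bil V b b / 2))%:E)%E.
Proof.
pose f v := c * expR (- (bil M (tuple_row v) (tuple_row v) / 2)).
have mexp : measurable_fun setT (fun v => expR (- (bil M (tuple_row v) (tuple_row v) / 2))).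
  apply: measurableT_comp => //; apply: measurableT_comp => //.
  by apply: measurable_funM => //; exact: measurable_bil_tuple.
have mf : measurable_fun setT f by exact: measurable_funM.
have mF : measurable_fun setT (fun v => (expR (linear_functional b v))%:E).
  apply/measurable_EFinP; apply: measurableT_comp => //.
  exact: measurable_linear_functional.
rewrite (ge0_integral_distribution_density (mu := lebesgue_tuple R N) (X := X)
  mf X_law mF)//.
pose a := b *m V.
have bil_shift u : bil M (u + a) (u + a) =
    bil M u u + 2 * bil 1%:M b u + bil V b b.
  have Ma w : bil M a w = bil 1%:M b w by rewrite /bil mulmx1 /a mulmxKV.
  have ab : bil M a a = bil V b b.
    by rewrite Ma /bil mulmx1 trmx_mul VT mulmxA.
  rewrite bilDl !bilDr (bilC u a MT) Ma ab; ring.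
rewrite -(ge0_integral_lebesgue_tuple_translation (a 0)); last 2 first.
- by apply: emeasurable_funM => //; exact/measurable_EFinP.
- by move=> v; rewrite -EFinM lee_fin !mulr_ge0// expR_ge0.
transitivity (\int[lebesgue_tuple R N]_v ((expR (bil V b b / 2))%:E * (EFin \o f) v))%E.
  apply: eq_integral => v _; rewrite /= -!EFinM /f tuple_row_add bil_shift.
  rewrite !linear_functionalE tuple_row_add bilDr.
  have -> : bil 1%:M b a = bil V b b.
    by rewrite /bil mulmx1 trmx_mul VT mulmxA.
  congr EFin; rewrite !(mulrCA _ c) -!expRD; by congr (_ * expR _); field.
rewrite ge0_integralZl//; last 2 first.
- exact/measurable_EFinP.
- by move=> v _; rewrite lee_fin mulr_ge0// expR_ge0.
(* The remaining integral is the total mass of the law, so the normalising constant [c] is never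
   computed. *)
- by rewrite -X_law// preimage_setT probability_setT mule1.
Qed.

Let Y b w := linear_functional b (X w).

Let mY b : measurable_fun setT (Y b).
Proof. by apply: measurableT_comp => //; exact: measurable_linear_functional. Qed.

Let mgfY b (t : R) :
  (\int[P]_w (expR (t * Y b w))%:E = (expR (t ^+ 2 * bil V b b / 2))%:E)%E.
Proof.
have -> : t ^+ 2 * bil V b b = bil V (t *: b) (t *: b).
  by rewrite bilZl bilZr; ring.
rewrite -gaussian_mgf; apply: eq_integral => w _.
by rewrite /Y !linear_functionalE bilZl.
Qed.

Let integrable_Y b : P.-integrable setT (EFin \o Y b).
Proof. exact: integrable_of_mgf (mY b) (mgfY b). Qed.

Let integrable_sqrY b : P.-integrable setT (EFin \o (fun w => Y b w ^+ 2)).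
Proof. exact: integrable_sqr_of_mgf (mY b) (mgfY b). Qed.

(** Polarisation: mixed moments reduce to second moments of single linear functionals. *)
Let mulYE b b' w : Y b w * Y b' w =
  2^-1 * (Y (b + b') w ^+ 2 - Y b w ^+ 2 - Y b' w ^+ 2).
Proof.
have -> : Y (b + b') w = Y b w + Y b' w by rewrite /Y !linear_functionalE bilDl.
by field.
Qed.

Let integrableB_real (f g : T -> R) : P.-integrable setT (EFin \o f) ->
  P.-integrable setT (EFin \o g) -> P.-integrable setT (EFin \o (f \- g)).
Proof. by move=> If Ig; exact: (integrableB measurableT If Ig). Qed.

Let integrable_mulY b b' : P.-integrable setT (EFin \o (fun w => Y b w * Y b' w)).
Proof.
rewrite (_ : _ \o _ = fun w => (2^-1)%:E *
    (Y (b + b') w ^+ 2 - Y b w ^+ 2 - Y b' w ^+ 2)%:E)%E; last first.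
  by apply/funext => w /=; rewrite mulYE.
apply: integrableZl => //.
by apply: integrableB_real => //; exact: integrableB_real.
Qed.

Let expectation_Rintegral (f : T -> R) : P.-integrable setT (EFin \o f) ->
  ('E_P[f] = (\int[P]_w f w)%:E)%E.
Proof. by move=> If; rewrite unlock /Rintegral fineK// integrable_fin_num. Qed.

(** The means vanish, so the covariance is the mixed moment. Polarising it and then expanding
    [bil V] at [b + b'] leaves the cross term, by symmetry of [V]. *)
Lemma gaussian_covariance b b' :
  covariance P (fun w => linear_functional b (X w))
    (fun w => linear_functional b' (X w)) = (bil V b b')%:E.
Proof.
have lY a : Y a \in Lfun P 1 by apply/Lfun1_integrable; exact: integrable_Y.
have iYY := integrable_mulY b b'.
have lYY : (Y b * Y b')%R \in Lfun P 1 by apply/Lfun1_integrable; exact: iYY.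
rewrite (covarianceE (lY b) (lY b') lYY) (expectation_Rintegral iYY).
rewrite (expectation_Rintegral (integrable_Y b)) (expectation_Rintegral (integrable_Y b')).
rewrite (mean0_of_mgf (gaussian_variance_ge0 b) (mY b) (mgfY b)) mul0e sube0.
rewrite (eq_Rintegral _ (fun w _ => mulYE b b' w)).
rewrite RintegralZl//; last by apply: integrableB_real => //; exact: integrableB_real.
rewrite RintegralB//; last exact: integrableB_real.
rewrite RintegralB//.
have m2 d := second_moment_of_mgf (gaussian_variance_ge0 d) (mY d) (mgfY d).
rewrite !m2 bilDl !bilDr (bilC b' b VT); congr EFin; by field.
Qed.

End gaussian_density.

(** * Small-mass asymptotics of the resolvent *)

Lemma bil1E (R : comNzRingType) (N : nat) (v : 'rV[R]_N) :
  bil 1%:M v v = \sum_i v 0 i ^+ 2.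
Proof. by rewrite /bil mulmx1 mxE; apply: eq_bigr => i _; rewrite mxE expr2. Qed.

Lemma bilMD (R : comNzRingType) (N : nat) (A B : 'M[R]_N) (u v : 'rV[R]_N) :
  bil (A + B) u v = bil A u v + bil B u v.
Proof. by rewrite /bil mulmxDr mulmxDl mxE. Qed.

Lemma bilMZ (R : comNzRingType) (N : nat) k (A : 'M[R]_N) (u v : 'rV[R]_N) :
  bil (k *: A) u v = k * bil A u v.
Proof. by rewrite /bil -scalemxAr -scalemxAl mxE. Qed.

(** A row vector annihilated by [A] has form zero, so the rows of [A] are free. *)
Lemma posdef_unitmx (R : realFieldType) (N : nat) (A : 'M[R]_N) :
  (forall v, bil A v v = 0 -> v = 0) -> A \in unitmx.
Proof.
move=> A0; rewrite -row_free_unit; apply/inj_row_free => v vA.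
by apply: A0; rewrite /bil vA mul0mx mxE.
Qed.

Section resolvent.
Context (R : realFieldType) (N : nat).
Variables (L : 'M[R]_N).
Hypotheses (N_gt0 : (0 < N)%N) (LT : L^T = L).
Hypothesis L_ge0 : forall v, 0 <= bil L v v.
Hypothesis L1 : L *m const_mx 1 = 0 :> 'M[R]_N.
Hypothesis L_ker : forall v, bil L v v = 0 -> forall i j, v 0 i = v 0 j.

Definition massive (r : R) : 'M[R]_N := L + r%:M.

Lemma massive_sym r : (massive r)^T = massive r.
Proof. by rewrite /massive linearD /= LT tr_scalar_mx. Qed.

Lemma bil_massive_ge r (v : 'rV[R]_N) : r * \sum_i v 0 i ^+ 2 <= bil (massive r) v v.
Proof. by rewrite bilMD -scalemx1 bilMZ bil1E lerDr. Qed.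

Lemma massive_unit r : 0 < r -> massive r \in unitmx.
Proof.
move=> r0; apply: posdef_unitmx => v v0.
have s0 : \sum_i v 0 i ^+ 2 = 0.
  apply/eqP; rewrite eq_le sumr_ge0 ?andbT => [|i _]; last exact: sqr_ge0.
  by rewrite -(pmulr_rle0 _ r0) (le_trans (bil_massive_ge r v))// v0.
apply/rowP => i; rewrite mxE; apply/eqP; rewrite -sqrf_eq0; apply/eqP.
by move/psumr_eq0P : s0; apply=> // j _; exact: sqr_ge0.
Qed.

Let ones : 'M[R]_N := const_mx 1.
(** The added term is the orthogonal projection onto the constants. It repairs the kernel of [L] and
    vanishes on vectors of sum zero. *)
Let H := L + N%:R^-1 *: ones.

Let N_neq0 : N%:R != 0 :> R. Proof. by rewrite pnatr_eq0 -lt0n. Qed.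

Let bil_ones (v : 'rV[R]_N) : bil ones v v = (\sum_i v 0 i) ^+ 2.
Proof.
rewrite /bil mxE expr2 mulr_sumr; apply: eq_bigr => j _; rewrite !mxE.
by congr (_ * _); apply: eq_bigr => i _; rewrite mxE mulr1.
Qed.

(** If the form vanishes, so do both nonnegative summands: one makes [v] constant, the other makes
    its sum zero. *)
Let H_unit : H \in unitmx.
Proof.
apply: posdef_unitmx => v; rewrite bilMD bilMZ bil_ones => /eqP.
have q0 : 0 <= N%:R^-1 * (\sum_i v 0 i) ^+ 2 by rewrite mulr_ge0 ?invr_ge0 ?sqr_ge0.
rewrite paddr_eq0// mulf_eq0 invr_eq0 (negbTE N_neq0)/= sqrf_eq0.
move=> /andP[/eqP/L_ker vc /eqP s0].
apply/rowP => i; rewrite mxE; apply/eqP; rewrite -(mulrI_eq0 _ (lregP N_neq0)).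
rewrite -s0 (eq_bigr (fun=> v 0 i)) => [|j _]; last exact: vc.
by rewrite sumr_const card_ord mulr_natl.
Qed.

Let ones_sq : ones *m ones = N%:R *: ones.
Proof.
apply/matrixP => i j; rewrite !mxE (eq_bigr (fun=> 1)) => [|k _].
  by rewrite sumr_const card_ord mulr1.
by rewrite !mxE mulr1.
Qed.

Let onesL : ones *m L = 0.
Proof. by rewrite -[LHS]trmxK trmx_mul LT trmx_const L1 trmx0. Qed.

Let G := invmx H.

Let onesG : ones *m G = ones.
Proof.
have onesH : ones *m H = ones.
  by rewrite /H mulmxDr onesL add0r -scalemxAr ones_sq scalerA mulVf// scale1r.
by rewrite -[in LHS]onesH mulmxK.
Qed.

Let LG : L *m G = 1%:M - N%:R^-1 *: ones.
Proof.
have -> : L = H - N%:R^-1 *: ones by rewrite /H addrK.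
by rewrite mulmxBl mulmxV// -scalemxAl onesG.
Qed.

(* [G] inverts [L] on the vectors of sum zero. *)
Let resolventE r : 0 < r -> r *: invmx (massive r) =
  N%:R^-1 *: ones + r *: (G - r *: invmx (massive r) *m G).
Proof.
move=> r0; set V := invmx _; have uM := massive_unit r0.
have MG : massive r *m G = 1%:M - N%:R^-1 *: ones + r *: G.
  by rewrite mulmxDl LG mul_scalar_mx.
have rVones : r *: (V *m ones) = ones.
  have Mones : massive r *m ones = r *: ones.
    by rewrite mulmxDl L1 add0r mul_scalar_mx.
  by rewrite scalemxAr -Mones mulmxA mulVmx// mul1mx.
(* This is [MG] multiplied by [V] on the left. Substituted for the first [G] of the goal, it leaves
   only [rVones] to apply. *)
have GE : G = V - N%:R^-1 *: (V *m ones) + r *: (V *m G).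
  rewrite -[LHS]mul1mx -(mulVmx uM) -mulmxA MG mulmxDr mulmxBr mulmx1.
  by rewrite -!scalemxAr.
rewrite {1}GE -scalemxAl addrK scalerBr !scalerA (mulrC r) -scalerA rVones.
by rewrite addrC subrK.
Qed.

Lemma massive_inv_sym r : (invmx (massive r))^T = invmx (massive r).
Proof. by rewrite trmx_inv massive_sym. Qed.

(** The form of [massive r] at row [i] of its inverse [V] equals [V i i] and dominates
    [r * V i k ^+ 2] for every [k]. The case [k = i] gives [r * V i i <= 1], and [k = j] then bounds
    the square of [r * V i j] by 1. *)
Let resolvent_bounded r i j : 0 < r -> `|r * invmx (massive r) i j| <= 1.
Proof.
move=> r0; set V := invmx _; have uM := massive_unit r0.
have ge k : r * V i k ^+ 2 <= V i i.
  have := bil_massive_ge r (row i V).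
  have -> : bil (massive r) (row i V) (row i V) = V i i.
    rewrite /bil rowE trmx_mul massive_inv_sym -!mulmxA.
    rewrite [massive r *m _]mulmxA mulmxV// mul1mx mulmxA.
    exact: bil_delta.
  apply: le_trans; rewrite ler_pM2l// (bigD1 k)//= mxE lerDl.
  by apply: sumr_ge0 => l _; exact: sqr_ge0.
have Vii0 : 0 <= V i i by apply: le_trans (ge i); rewrite mulr_ge0 ?sqr_ge0// ltW.
have rVii : r * V i i <= 1.
  have [->|Vn0] := eqVneq (V i i) 0; first by rewrite mulr0.
  have Vp : 0 < V i i by rewrite lt_neqAle eq_sym Vn0.
  by rewrite -(ler_pM2r Vp) mul1r -mulrA -expr2.
rewrite -(ler_pXn2r (n := 2))// ?nnegrE// expr1n real_normK ?num_real//.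
rewrite exprMn expr2 -mulrA; apply: le_trans rVii.
by rewrite ler_pM2l.
Qed.

Lemma resolvent_approx : exists C : R, forall (r : R) (i j : 'I_N), 0 < r ->
  `|r * invmx (massive r) i j - N%:R^-1| <= C * r.
Proof.
(* [C] dominates each entry of [G] and each column sum of absolute values. The latter handles the
   product with [G], as the entries of [r *: invmx (massive r)] are at most 1 in absolute value. *)
pose C : R := \sum_k \sum_l `|G k l|.
have GC i j : `|G i j| <= C.
  rewrite /C (bigD1 i)//= (bigD1 j)//= -addrA lerDl addr_ge0 ?sumr_ge0// => k _.
  by rewrite sumr_ge0.
exists (C + C) => r i j r0.
have /matrixP/(_ i j) := resolventE r0.
rewrite ![in LHS]mxE => ->; rewrite !mxE mulr1 addrAC subrr add0r.
rewrite normrM (gtr0_norm r0) mulrC ler_pM2r//.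
apply: (le_trans (ler_normB _ _)); apply: lerD; first exact: GC.
apply: (le_trans (ler_norm_sum _ _ _)).
rewrite /C exchange_big/= [leRHS](bigD1 j)//= -[leLHS]addr0 lerD//; last first.
  by rewrite sumr_ge0// => k _; rewrite sumr_ge0.
apply: ler_sum => k _; rewrite normrM -[leRHS]mul1r ler_wpM2r//.
by rewrite mxE resolvent_bounded.
Qed.

End resolvent.

(** * Laplacian of the weighted Hamming graph *)

Section laplacian.
Context (R : realFieldType) (N : nat).
Implicit Types c : 'M[R]_N.

Definition laplacian c : 'M[R]_N :=
  \matrix_(i, j) ((i == j)%:R * \sum_k c i k - c i j).

Lemma laplacian_sym c : c^T = c -> (laplacian c)^T = laplacian c.
Proof.
move=> cT; apply/matrixP => i j; rewrite !mxE eq_sym.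
have -> : c j i = c i j by rewrite -[in LHS]cT mxE.
by have [->|_] := eqVneq i j; rewrite ?mul0r.
Qed.

Lemma laplacian_ones c : laplacian c *m const_mx 1 = 0 :> 'M[R]_N.
Proof.
apply/matrixP => i j; rewrite !mxE.
under eq_bigr do rewrite !mxE mulr1.
rewrite sumrB (bigD1 i)//= eqxx mul1r [X in _ + X - _]big1 ?addr0 ?subrr// => k ki.
by rewrite eq_sym (negbTE ki) mul0r.
Qed.

(** By symmetry of [c] the two squares in the expansion both sum to [D]. The factor 1/2 compensates
    for counting each edge in both orders. *)
Lemma bil_laplacian c (v : 'rV[R]_N) : c^T = c ->
  bil (laplacian c) v v = 2^-1 * \sum_i \sum_j c i j * (v 0 i - v 0 j) ^+ 2.
Proof.
move=> cT; have cS i j : c j i = c i j by rewrite -[in LHS]cT mxE.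
pose D := \sum_i \sum_j c i j * v 0 i ^+ 2.
pose E := \sum_i \sum_j c i j * (v 0 i * v 0 j).
have -> : bil (laplacian c) v v = D - E.
  rewrite /bil mxE /D /E -sumrB; apply: eq_bigr => j _.
  rewrite !mxE -mulr_suml.
  rewrite (eq_bigr (fun k => v 0 k * ((k == j)%:R * \sum_l c k l) - v 0 k * c k j)).
    rewrite sumrB (bigD1 j)//= eqxx mul1r [X in _ + X - _]big1 ?addr0 => [|k kj]; last first.
      by rewrite (negbTE kj) mul0r mulr0.
    rewrite mulrBl; congr (_ - _); first by ring.
    by rewrite mulr_suml; apply: eq_bigr => k _; rewrite cS; ring.
  by move=> k _; rewrite !mxE mulrBr.
have DE : D = \sum_i \sum_j c i j * v 0 j ^+ 2.
  by rewrite /D exchange_big; apply: eq_bigr => i _; apply: eq_bigr => j _; rewrite cS.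
have -> : \sum_i \sum_j c i j * (v 0 i - v 0 j) ^+ 2 = D + D - 2 * E.
  rewrite {2}DE mulr_sumr -big_split -sumrB; apply: eq_bigr => i _ /=.
  rewrite mulr_sumr -big_split -sumrB; apply: eq_bigr => j _ /=; ring.
by field.
Qed.

Lemma laplacian_ge0 c (v : 'rV[R]_N) : c^T = c -> (forall i j, 0 <= c i j) ->
  0 <= bil (laplacian c) v v.
Proof.
move=> cT c0; rewrite bil_laplacian// mulr_ge0// sumr_ge0// => i _.
by rewrite sumr_ge0// => j _; rewrite mulr_ge0// sqr_ge0.
Qed.

Lemma laplacian_eq0 c (v : 'rV[R]_N) : c^T = c -> (forall i j, 0 <= c i j) ->
  bil (laplacian c) v v = 0 -> forall i j, c i j != 0 -> v 0 i = v 0 j.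
Proof.
move=> cT c0 + i j cij; rewrite bil_laplacian// => /eqP.
have t0 k l : 0 <= c k l * (v 0 k - v 0 l) ^+ 2 by rewrite mulr_ge0// sqr_ge0.
rewrite mulf_eq0 invr_eq0 pnatr_eq0/= => /eqP.
move/psumr_eq0P => /(_ (fun k _ => sumr_ge0 _ (fun l _ => t0 k l))) /(_ i isT).
move/psumr_eq0P => /(_ (fun l _ => t0 i l)) /(_ j isT)/eqP.
by rewrite mulf_eq0 (negbTE cij)/= sqrf_eq0 subr_eq0 => /eqP.
Qed.

End laplacian.

(** A nonzero entry of [A ^+ k] contains a path of [k] nonzero entries of [A], along which [h] does
    not change. *)
Lemma irreducible_mx_constant (R : realType) (N : nat) (A : 'M[R]_N)
    (U : eqType) (h : 'I_N -> U) : irreducible_mx A ->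
  (forall i j, A i j != 0 -> h i = h j) -> forall i j, h i = h j.
Proof.
move=> irrA Ah i j; have [k /gt_eqF/negbT] := irrA i j.
elim: k i => [|k IH] i.
  rewrite expr0 mxE; have [->//|_] := eqVneq i j; by rewrite eqxx.
rewrite exprS mxE => s0.
have [l] : exists l, A i l * (A ^+ k) l j != 0.
  apply/existsP; apply: contraNT s0; rewrite negb_exists => /forallP l0.
  by rewrite big1// => l _; apply/eqP; rewrite -[_ == _]negbK.
by rewrite mulf_eq0 negb_or => /andP[/Ah -> /IH].
Qed.

(** * The Hamiltonian of the Hamming graph as a quadratic form *)

Section hamming_graph.
Context (R : realType) (d n : nat).
Implicit Types (x y : hamming d n) (J : nat -> R).

Lemma rho_le x y : (rho x y <= d)%N.
Proof. by rewrite (leq_trans (max_card _))// card_ord. Qed.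

Lemma rhoC x y : rho x y = rho y x.
Proof. by apply: eq_card => i; rewrite !inE eq_sym. Qed.

Lemma rho_eq0 x y : (rho x y == 0)%N = (x == y).
Proof.
apply/idP/eqP => [|->]; last by rewrite /rho cards_eq0; apply/eqP/setP => i; rewrite !inE eqxx.
rewrite /rho cards_eq0 => /eqP/setP xy; apply/ffunP => i.
by have := xy i; rewrite !inE => /negbFE/eqP.
Qed.

Lemma card_hamming : #|hamming d n| = (n ^ d)%N.
Proof. by rewrite card_ffun !card_ord. Qed.

(** The diagonal is set to zero because [J 0] is an arbitrary value, possibly negative. *)
Definition edge_weight J x y : R := if x == y then 0 else J (rho x y).

Definition coupling J : 'M[R]_#|hamming d n| :=
  \matrix_(i, j) edge_weight J (enum_val i) (enum_val j).

Lemma coupling_sym J : (coupling J)^T = coupling J.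
Proof. by apply/matrixP => i j; rewrite !mxE /edge_weight eq_sym rhoC. Qed.

Lemma coupling_ge0 J : (forall i, (1 <= i <= d)%N -> 0 <= J i) ->
  forall i j, 0 <= coupling J i j.
Proof.
move=> J0 i j; rewrite mxE /edge_weight; case: ifPn => // xy.
by rewrite J0// rho_le lt0n rho_eq0 xy.
Qed.

(** A pair of distinct vertices lies in exactly one shell, with index between 1 and [d]; a diagonal
    pair contributes zero on both sides. *)
Lemma sum_shell J (F : hamming d n -> hamming d n -> R) :
  (forall x, F x x = 0) ->
  \sum_(1 <= i < d.+1) J i * \sum_(p in @shell d n i) F p.1 p.2 =
  \sum_x \sum_y edge_weight J x y * F x y.
Proof.
move=> F0; rewrite pair_bigA/=.
under eq_bigr do rewrite mulr_sumr big_mkcond/=.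
rewrite exchange_big/=; apply: eq_bigr => -[x y] _ /=; rewrite /edge_weight.
case: eqVneq => [->|xy]; first by rewrite mul0r big1// => i _; rewrite F0 mulr0 if_same.
rewrite (bigD1_seq (rho x y)) ?iota_uniq//=; last first.
  by rewrite mem_index_iota lt0n rho_eq0 xy ltnS rho_le.
rewrite inE eqxx big1 ?addr0// => i ir.
by rewrite inE/= eq_sym (negbTE ir).
Qed.

(** The factor 1/4 is the 1/2 in front of the whole form times the 1/2 for ordered pairs in
    [bil_laplacian]. *)
Lemma hamiltonianE J m (v : #|hamming d n|.-tuple R) :
  hamiltonian J m (fun x => tnth v (enum_rank x)) =
  bil (massive (laplacian (coupling J)) (m ^+ 2)) (tuple_row v) (tuple_row v) / 2.
Proof.
set xi := fun x => _.
have enumE (F : hamming d n -> R) :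
    \sum_x F x = \sum_(i < #|hamming d n|) F (enum_val i).
  by rewrite -big_enum_val.
have xiE i : tuple_row v 0 i = xi (enum_val i) by rewrite mxE /xi enum_valK.
rewrite bilMD -scalemx1 bilMZ bil1E bil_laplacian; last exact: coupling_sym.
rewrite /hamiltonian (sum_shell J (F := fun x y => (xi x - xi y) ^+ 2)); last first.
  by move=> x; rewrite subrr expr0n.
rewrite !enumE mulrDl; congr (_ + _); rewrite [RHS]mulrAC; congr (_ * _).
- by field.
- apply: eq_bigr => i _; rewrite enumE; apply: eq_bigr => j _.
  by rewrite !xiE mxE.
- by apply: eq_bigr => i _; rewrite xiE.
Qed.

(** Off the diagonal, an entry of the transition matrix vanishes wherever the coupling does; a
    diagonal entry joins a vertex to itself. So irreducibility carries over to the coupling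
    graph. *)
Lemma coupling_connected J (U : eqType) (h : 'I_#|hamming d n| -> U) :
  irreducible_mx (transition_mx d n J) ->
  (forall i j, coupling J i j != 0 -> h i = h j) -> forall i j, h i = h j.
Proof.
move=> irrP ch; apply: (irreducible_mx_constant irrP) => i j.
rewrite mxE /weight rho_eq0; have [/enum_val_inj->//|xy Pij] := eqVneq (enum_val i) (enum_val j).
apply: ch; rewrite mxE /edge_weight (negbTE xy).
by apply: contraNneq Pij => ->; rewrite mulr0 mul0r.
Qed.

End hamming_graph.

(** * Covariance of the free field *)

Section free_field.
Context (R : realType) (d n : nat) (J : nat -> R) (beta m : R).
Hypotheses (beta_gt0 : 0 < beta) (m_gt0 : 0 < m).
Hypothesis J_ge0 : forall i, (1 <= i <= d)%N -> 0 <= J i.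
Context (dsp : measure_display) (T : measurableType dsp) (P : probability T R).
Variable g : hamming d n -> {RV P >-> R}.
Hypothesis g_gff : is_gff J beta m g.

Let Q := massive (laplacian (coupling d n J)) (m ^+ 2).

Let L_sym : (laplacian (coupling d n J))^T = laplacian (coupling d n J).
Proof. exact/laplacian_sym/coupling_sym. Qed.

Let L_ge0 v : 0 <= bil (laplacian (coupling d n J)) v v.
Proof. by apply: laplacian_ge0; [exact: coupling_sym|exact: coupling_ge0]. Qed.

Let field_vector t := [tuple g (enum_val i) t | i < #|hamming d n|].

Let measurable_field_vector : measurable_fun setT field_vector.
Proof.
apply/measurable_fun_tnthP => i.
by rewrite (_ : _ \o _ = g (enum_val i))//; apply/funext => t /=; rewrite tnth_mktuple.
Qed.

HB.instance Definition _ :=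
  isMeasurableFun.Build _ _ _ _ field_vector measurable_field_vector.

(** The law is Gaussian with precision matrix [beta *: Q], tested against coordinate vectors scaled
    by [a]. The value [a = 1] serves the field itself and [a = m] the rescaled field. *)
Lemma gff_covariance (a : R) x y :
  covariance P (fun t => a * g x t) (fun t => a * g y t) =
  (a ^+ 2 * (beta^-1 * invmx Q (enum_rank x) (enum_rank y)))%:E.
Proof.
have [c c0 g_law] := g_gff.
have m2 : 0 < m ^+ 2 by rewrite exprn_gt0.
have QT : (beta *: Q)^T = beta *: Q.
  by rewrite linearZ/= massive_sym.
have Q_unit : beta *: Q \in unitmx.
  by rewrite unitmxZ ?unitfE ?gt_eqF// massive_unit.
have Q_ge0 v : 0 <= bil (beta *: Q) v v.
  rewrite bilMZ mulr_ge0 ?(ltW beta_gt0)//; apply: le_trans (bil_massive_ge L_ge0 _ v).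
  by rewrite mulr_ge0 ?(ltW m2)// sumr_ge0// => i _; exact: sqr_ge0.
have densityE (v : #|hamming d n|.-tuple R) :
    expR (- (beta * hamiltonian J m (fun x => tnth v (enum_rank x)))) =
    expR (- (bil (beta *: Q) (tuple_row v) (tuple_row v) / 2)).
  by rewrite hamiltonianE bilMZ mulrA.
have X_law A : measurable A -> (P (field_vector @^-1` A) =
    \int[lebesgue_tuple R #|hamming d n|]_(v in A)
     (c * expR (- (bil (beta *: Q) (tuple_row v) (tuple_row v) / 2)))%:E)%E.
  move=> mA; rewrite (g_law A mA).
  apply: eq_integral => v _.
  by rewrite densityE.
have := gaussian_covariance (X := field_vector) (ltW c0) QT Q_unit Q_ge0 X_law
  (a *: delta_mx 0 (enum_rank x)) (a *: delta_mx 0 (enum_rank y)).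
have fE z : (fun w => linear_functional (a *: delta_mx 0 (enum_rank z)) (field_vector w)) =
    (fun t => a * g z t).
  apply/funext => t; rewrite /linear_functional (bigD1 (enum_rank z))//= big1 ?addr0.
    by rewrite !mxE !eqxx mulr1 tnth_mktuple enum_rankK.
  by move=> i iz; rewrite !mxE (negbTE iz) andbF mulr0 mul0r.
rewrite !fE => ->; rewrite bilZl bilZr bil_delta invmxZ// mxE.
by rewrite mulrA -expr2.
Qed.

End free_field.

(** * Limits as the mass tends to zero *)

Lemma cvg_EFin_near (R : realType) (S : Type) (F : set_system S) (f : S -> \bar R)
    (h : S -> R) (l : R) : Filter F ->
  (\forall x \near F, f x = (h x)%:E) -> h @ F --> l -> f @ F --> l%:E.
Proof.
move=> FF fh hl; apply: cvg_EFin; first by apply: filterS fh => x ->.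
apply: cvg_trans hl; apply: near_eq_cvg.
by apply: filterS fh => x /= ->.
Qed.

Theorem corollary3p7 (R : realType) (d n : nat) (hd : (2 <= d)%N)
    (hn : (2 <= n)%N) (beta : R) (hbeta : 0 < beta) (J : nat -> R)
    (J_ge0 : forall i : nat, (1 <= i <= d)%N -> 0 <= J i)
    (J_sum : \sum_(1 <= i < d.+1) (kappa d n i)%:R * J i <= 1)
    (P_irr : irreducible_mx (transition_mx d n J))
    (dsp : R -> measure_display) (T : forall m : R, measurableType (dsp m))
    (P : forall m : R, probability (T m) R)
    (g : forall m : R, hamming d n -> {RV (P m) >-> R})
    (g_gff : forall m : R, 0 < m -> is_gff J beta m (g m)) :
  forall x x' : hamming d n,
    [/\ ((n%:R ^+ d * m ^+ 2)%:E * covariance (P m) (g m x) (g m x'))%E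
          @[m --> 0^'+] --> (beta^-1)%:E,
        covariance (P m) (g m x) (g m x') @[m --> 0^'+] --> +oo%E &
        correlation (P m) (fun t => m * g m x t) (fun t => m * g m x' t)
          @[m --> 0^'+] --> 1%E ].
Proof.
have n_gt0 : (0 < n)%N by exact: leq_trans hn.
set N := #|hamming d n|.
have N_gt0 : (0 < N)%N by rewrite /N card_hamming expn_gt0 n_gt0.
have NR : 0 < N%:R :> R by rewrite ltr0n.
pose L := laplacian (coupling d n J).
have L_ge0 v : 0 <= bil L v v.
  by apply: laplacian_ge0; [exact: coupling_sym|exact: coupling_ge0].
have L_ker v : bil L v v = 0 -> forall i j, v 0 i = v 0 j.
  move=> v0; apply: (coupling_connected P_irr).
  exact: (laplacian_eq0 (coupling_sym d n J) (coupling_ge0 J_ge0) v0).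
have [C W_approx] := resolvent_approx N_gt0 (laplacian_sym (coupling_sym d n J))
  L_ge0 (laplacian_ones _) L_ker.
(* [W] has the finite limit [N%:R^-1]. Up to [beta^-1] it is the covariance of the rescaled field,
   and divided by [m ^+ 2] that of the field. *)
pose W x y (m : R) := m ^+ 2 * invmx (massive L (m ^+ 2)) (enum_rank x) (enum_rank y).
have sqr0 : m ^+ 2 @[m --> 0^'+] --> (0 : R).
  have := @exprn_continuous R 2 0; rewrite /continuous_at expr0n /= => h.
  exact: cvg_at_right_filter h.
have W_cvg x y : W x y m @[m --> 0^'+] --> (N%:R^-1 : R).
  apply/cvgrPdist_le => e e0.
  have : C * m ^+ 2 @[m --> 0^'+] --> (C * 0 : R) by exact: cvgMl_tmp.
  rewrite mulr0 => /cvgr_lt /(_ _ e0); apply: filter_app.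
  near=> m; move=> /ltW; apply: le_trans; rewrite distrC.
  by apply: W_approx; rewrite exprn_gt0.
have covE (a m : R) x y : 0 < m ->
    covariance (P m) (fun t => a * g m x t) (fun t => a * g m y t) =
    (a ^+ 2 / m ^+ 2 * (beta^-1 * W x y m))%:E.
  move=> m0; rewrite (gff_covariance hbeta m0 J_ge0 (g_gff m m0)).
  by congr EFin; rewrite /W; field; rewrite !gt_eqF.
have cov1E (m : R) x y : 0 < m ->
    covariance (P m) (g m x) (g m y) = (beta^-1 * W x y m / m ^+ 2)%:E.
  move=> m0; have := covE 1 m x y m0; rewrite expr1n mul1r mulrC => <-.
  by congr covariance; apply/funext => t; rewrite mul1r.
have covmE (m : R) x y : 0 < m ->
    covariance (P m) (fun t => m * g m x t) (fun t => m * g m y t) =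
    (beta^-1 * W x y m)%:E.
  by move=> m0; rewrite covE// divff ?mul1r// gt_eqF// exprn_gt0.
have bW_cvg x y : beta^-1 * W x y m @[m --> 0^'+] --> (beta^-1 / N%:R : R).
  by apply: cvgMl_tmp; exact: W_cvg.
have bN : 0 < beta^-1 / N%:R by rewrite divr_gt0// invr_gt0.
move=> x x'; split.
- have lim1 : N%:R * (beta^-1 * W x x' m) @[m --> 0^'+] -->
      (N%:R * (beta^-1 / N%:R) : R).
    by apply: cvgMl_tmp; exact: bW_cvg.
  rewrite (mulrCA N%:R) mulfV ?mulr1 ?gt_eqF// in lim1.
  apply: cvg_EFin_near lim1; near=> m.
  rewrite /= cov1E// -EFinM -natrX -card_hamming -/N; congr EFin.
  by field; rewrite !gt_eqF.
(* Multiplied by [m ^+ 2], the claim is that [beta^-1 * W x x' m - A * m ^+ 2] is eventually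
   nonnegative, which holds since its limit is positive. *)
- apply/cvgeyPge => A; near=> m.
  have m0 : 0 < m by [].
  rewrite cov1E// lee_fin ler_pdivlMr ?exprn_gt0// -subr_ge0.
  near: m.
  have : beta^-1 * W x x' m - A * m ^+ 2 @[m --> 0^'+] --> (beta^-1 / N%:R - A * 0 : R).
    by apply: cvgB; [exact: bW_cvg|exact: cvgMl_tmp].
  rewrite mulr0 subr0 => /cvgr_gt /(_ _ bN); apply: filterS => m; exact: ltW.
(* Both variances and the covariance of the rescaled field share the positive limit
   [beta^-1 / N%:R], so the quotient tends to 1. *)
- have sqrt_cvg y : Num.sqrt (beta^-1 * W y y m) @[m --> 0^'+] -->
      (Num.sqrt (beta^-1 / N%:R) : R).
    by apply: continuous_cvg; [exact: sqrt_continuous|exact: bW_cvg].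
  have sN : 0 < Num.sqrt (beta^-1 / N%:R) by rewrite sqrtr_gt0.
  have lim3 : beta^-1 * W x x' m /
      (Num.sqrt (beta^-1 * W x x m) * Num.sqrt (beta^-1 * W x' x' m))
      @[m --> 0^'+] --> (beta^-1 / N%:R /
        (Num.sqrt (beta^-1 / N%:R) * Num.sqrt (beta^-1 / N%:R)) : R).
    apply: cvgM; first exact: bW_cvg.
    by apply: cvgV; [rewrite mulf_neq0// gt_eqF|exact: cvgM].
  rewrite -expr2 sqr_sqrtr ?(ltW bN)// divff ?gt_eqF// in lim3.
  apply: cvg_EFin_near lim3; near=> m.
  (* Positive variances keep the extended-real inverse away from its special value at zero. *)
  have Wx : 0 < beta^-1 * W x x m.
    by near: m; have /cvgr_gt/(_ _ bN) := bW_cvg x x.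
  have Wx' : 0 < beta^-1 * W x' x' m.
    by near: m; have /cvgr_gt/(_ _ bN) := bW_cvg x' x'.
  rewrite /correlation /variance !covmE// /= -EFinM inver ifF -?EFinM//.
  by rewrite mulf_eq0 !sqrtr_eq0 !leNgt Wx Wx'.
Unshelve. all: by end_near.
Qed.
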